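(* Let $a, h, d, k \in \mathbb{Z}_{\ge 1}$ with $\gcd(a,d) = 1$, and suppose that the numerical semigroup $\Gamma = \langle a, ah+d, ah+2d, \ldots, ah+kd\rangle$ is symmetric. Let $K$ be a field and let $R = K[\Gamma]$. Then for every 2-generated monomial ideal $M$ of $R$, viewed as an $R$-module, the torsion submodule of $M \otimes_R \operatorname{Hom}_R(M,R)$ is non-trivial (i.e. nonzero).
   Context: A numerical semigroup is a co-finite additive subsemigroup of $\mathbb{Z}_{\ge 0}$ containing $0$; $\langle n_1,\ldots,n_k\rangle = \{z_1n_1+\cdots+z_kn_k : z_i\in\mathbb{Z}_{\ge 0}\}$. The Frobenius number is $\mathsf{F}(\Gamma) = \max(\mathbb{Z}\setminus\Gamma)$. $\Gamma$ is symmetric if for every integer $n\notin\Gamma$ we have $\mathsf{F}(\Gamma)-n\in\Gamma$. A semigroup $\langle a, ah+d, \ldots, ah+kd\rangle$ as in the claim is said to be generated by a generalized arithmetic sequence. For a field $K$, the semigroup algebra $K[\Gamma]$ is the subring of the polynomial ring $K[x]$ consisting of all polynomials for which every term $x^n$ appearing with nonzero coefficient has $n\in\Gamma$; it is an integral domain. A 2-generated monomial ideal is an ideal of $K[\Gamma]$ generated by two monomials $x^{\alpha}, x^{\beta}$ with $\alpha,\beta\in\Gamma$, which is not principal, i.e. neither of the two monomials lies in the ideal generated by the other. The torsion submodule of a module $N$ over a domain $R$ is $\{u\in N : ru=0 \text{ for some nonzero } r\in R\}$. *)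

(* Defs.v *)
From HB Require Import structures.
From mathcomp Require Import all_boot all_order all_algebra.
From mathcomp Require Import boolp classical_sets functions.
From mathcomp.multinomials Require Import freeg.

Set Implicit Arguments.
Unset Strict Implicit.
Unset Printing Implicit Defensive.

Import GRing.Theory.

Local Open Scope ring_scope.
Local Open Scope quotient_scope.

Record numSemigroup := NumSemigroup {
  sg_mem :> {pred nat};
  sg_mem0 : 0%N \in sg_mem;
  sg_memD : forall m n, m \in sg_mem -> n \in sg_mem -> (m + n)%N \in sg_mem;
  sg_cofinite : exists N, forall n, (N <= n)%N -> n \in sg_mem
}.

(* [z \in Z \ G] includes all the negative integers, so that the Frobenius
   number of the whole of [nat] is [-1]. *)
Definition int_mem (G : numSemigroup) (z : int) : bool :=
  if z is Posz n then n \in G else false.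

Definition is_frobenius (G : numSemigroup) (F : int) : Prop :=
  ~~ int_mem G F /\ forall z, ~~ int_mem G z -> (z <= F)%R.

Definition symmetric_semigroup (G : numSemigroup) : Prop :=
  exists2 F, is_frobenius G F
           & forall z, ~~ int_mem G z -> int_mem G (F - z).

Definition semigroup_gen (s : seq nat) : {pred nat} :=
  [pred n | `[< exists z : 'I_(size s) -> nat,
                  n = (\sum_(i < size s) z i * nth 0 s i)%N >]].

Definition gen_arith_seq (a h d k : nat) : seq nat :=
  a :: [seq (a * h + i * d)%N | i <- iota 1 k].

Section SemigroupAlgebra.
Variables (K : fieldType) (G : numSemigroup).

Definition supported_in : {pred {poly K}} :=
  [pred p : {poly K} | [forall i : 'I_(size p), (p`_i != 0) ==> (val i \in G)]].

Lemma supported_inP (p : {poly K}) :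
  reflect (forall n, p`_n != 0 -> n \in G) (p \in supported_in).
Proof.
apply: (iffP forallP) => [H n pn0|H i]; last by apply/implyP; apply: H.
have ltn : (n < size p)%N.
  by rewrite ltnNge; apply: contra pn0 => /(nth_default 0) ->.
exact: (implyP (H (Ordinal ltn))).
Qed.

Lemma supported_inXn n : n \in G -> ('X^n : {poly K}) \in supported_in.
Proof.
move=> nG; apply/supported_inP => m; rewrite coefXn.
by case: (eqVneq m n) => [->//|_]; rewrite eqxx.
Qed.

Lemma supported_in_subring : subring_closed supported_in.
Proof.
split.
- by rewrite -[1](expr0 'X); exact/supported_inXn/sg_mem0.
- move=> p q /supported_inP Hp /supported_inP Hq; apply/supported_inP => n.
  rewrite coefB; have [p0|/Hp//] := eqVneq p`_n 0.
  by rewrite p0 sub0r oppr_eq0; exact: Hq.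
- move=> p q /supported_inP Hp /supported_inP Hq; apply/supported_inP => n.
  rewrite coefM => Hn; apply: contrapT => nG; move/eqP: Hn; apply.
  apply: big1 => i _; have [->|/Hp iG] := eqVneq p`_i 0; first by rewrite mul0r.
  have [->|/Hq jG] := eqVneq q`_(n - i) 0; first by rewrite mulr0.
  by case: nG; rewrite -(subnKC (ltn_ord i : (i <= n)%N)) sg_memD.
Qed.

HB.instance Definition _ :=
  GRing.isSubringClosed.Build {poly K} supported_in supported_in_subring.

Definition semigroup_algebra : Type := {p : {poly K} | p \in supported_in}.

HB.instance Definition _ := SubChoice.on semigroup_algebra.
HB.instance Definition _ :=
  [SubChoice_isSubComNzRing of semigroup_algebra by <:].

Definition sg_monomial (n : nat) (nG : n \in G) : semigroup_algebra :=
  exist _ 'X^n (supported_inXn nG).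

End SemigroupAlgebra.

Section Submodule.
Variables (R : comNzRingType) (V : lmodType R).

Section SubmoduleType.
Variable S : submodClosed V.

Definition submodule : Type := {x : V | x \in S}.

HB.instance Definition _ := SubChoice.on submodule.
HB.instance Definition _ := [SubChoice_isSubLmodule of submodule by <:].

End SubmoduleType.

Definition submodule_span (A : set V) : {pred V} :=
  [pred w | `[< forall S : submodClosed V,
                  (forall v, A v -> v \in S) -> w \in S >]].

Lemma submodule_span_closed A : submod_closed (submodule_span A).
Proof.
split; first by apply/asboolP => S _; exact: rpred0.
move=> r u v /asboolP Hu /asboolP Hv; apply/asboolP => S AS.
by rewrite rpredD ?rpredZ ?Hu ?Hv.
Qed.

HB.instance Definition _ A :=
  GRing.isSubmodClosed.Build R V (submodule_span A) (submodule_span_closed A).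

Lemma mem_submodule_span (A : set V) v : A v -> v \in submodule_span A.
Proof. by move=> Av; apply/asboolP => S; apply. Qed.

Definition torsion : set V :=
  [set u | exists2 r : R, r != 0 & r *: u = 0]%classic.

End Submodule.

Section HomModule.
Variables (R : comNzRingType) (M N : lmodType R).

Definition linear_pred : {pred M -> N} := [pred f : M -> N | `[< linear f >]].

Lemma linear_pred_submod_closed : submod_closed linear_pred.
Proof.
split; first by apply/asboolP => r x y; rewrite scaler0 addr0.
move=> c f g /asboolP Hf /asboolP Hg; apply/asboolP => r x y.
rewrite !fctE Hf Hg !scalerDr !scalerA [c * r]mulrC.
by rewrite -!addrA; congr (_ + _); rewrite addrCA.
Qed.

HB.instance Definition _ :=
  GRing.isSubmodClosed.Build R (M -> N) linear_pred linear_pred_submod_closed.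

Definition Hom_module : lmodType R := submodule linear_pred.

End HomModule.

Section Tensor.
Variables (R : comNzRingType) (M N : lmodType R).

Local Notation F := {freeg (M * N)%type / R}.
Local Notation e x y := (<< (x, y) >> : F).

Inductive tensor_rel : F -> Prop :=
| TensorDl x x' y : tensor_rel (e (x + x') y - (e x y + e x' y))
| TensorDr x y y' : tensor_rel (e x (y + y') - (e x y + e x y'))
| TensorZl r x y : tensor_rel (e (r *: x) y - r *: e x y)
| TensorZr r x y : tensor_rel (e x (r *: y) - r *: e x y).

Definition tensor_module : Type := Quotient.quot (submodule_span tensor_rel).

HB.instance Definition _ := GRing.Zmodule.on tensor_module.
HB.instance Definition _ := EqQuotient.on tensor_module.

Definition tensor_pi (u : F) : tensor_module := \pi u.

Local Notation pi := tensor_pi.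

Lemma tensor_piP (u v : F) : pi u = pi v <-> u - v \in submodule_span tensor_rel.
Proof. by rewrite Quotient.idealrBE; split=> [/eqP|/eqP]. Qed.

Lemma tensor_pi_surj t : exists u, t = pi u.
Proof. by exists (repr t); rewrite /tensor_pi reprK. Qed.

Lemma tensor_piD : {morph pi : u v / u + v}.
Proof. by move=> u v; exact: raddfD. Qed.

Definition tensor_scale (r : R) (t : tensor_module) : tensor_module :=
  pi (r *: repr t).

Lemma tensor_scale_pi r u : tensor_scale r (pi u) = pi (r *: u).
Proof.
apply/tensor_piP; rewrite -scalerBr rpredZ //.
by apply/tensor_piP; rewrite /tensor_pi reprK.
Qed.

Fact tensor_scaleA r s t :
  tensor_scale r (tensor_scale s t) = tensor_scale (r * s) t.
Proof.
by have [u ->] := tensor_pi_surj t; rewrite !tensor_scale_pi scalerA.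
Qed.

Fact tensor_scale1 : left_id 1 tensor_scale.
Proof.
by move=> t; have [u ->] := tensor_pi_surj t; rewrite tensor_scale_pi scale1r.
Qed.

Fact tensor_scaleDr : right_distributive tensor_scale +%R.
Proof.
move=> r t t'; have [u ->] := tensor_pi_surj t; have [v ->] := tensor_pi_surj t'.
by rewrite -tensor_piD !tensor_scale_pi -tensor_piD scalerDr.
Qed.

Fact tensor_scaleDl t : {morph tensor_scale^~ t : r s / r + s}.
Proof.
move=> r s; have [u ->] := tensor_pi_surj t.
by rewrite !tensor_scale_pi -tensor_piD scalerDl.
Qed.

HB.instance Definition _ := GRing.Zmodule_isLmodule.Build R tensor_module
  tensor_scaleA tensor_scale1 tensor_scaleDr tensor_scaleDl.

Definition tens (x : M) (y : N) : tensor_module := pi (e x y).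

Lemma tensor_piZ r u : pi (r *: u) = r *: pi u.
Proof. by rewrite -[LHS]tensor_scale_pi. Qed.

Lemma tensDl y : {morph tens^~ y : x x' / x + x'}.
Proof.
by move=> x x'; rewrite /tens -tensor_piD; apply/tensor_piP/mem_submodule_span/TensorDl.
Qed.

Lemma tensDr x : {morph tens x : y y' / y + y'}.
Proof.
by move=> y y'; rewrite /tens -tensor_piD; apply/tensor_piP/mem_submodule_span/TensorDr.
Qed.

Lemma tensZl r x y : tens (r *: x) y = r *: tens x y.
Proof. by rewrite /tens -tensor_piZ; apply/tensor_piP/mem_submodule_span/TensorZl. Qed.

Lemma tensZr r x y : tens x (r *: y) = r *: tens x y.
Proof. by rewrite /tens -tensor_piZ; apply/tensor_piP/mem_submodule_span/TensorZr. Qed.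

Lemma tensor_lift (P : lmodType R) (f : M -> N -> P) :
    (forall y, linear (f^~ y)) -> (forall x, linear (f x)) ->
  exists! g : tensor_module -> P, linear g /\ forall x y, g (tens x y) = f x y.
Proof.
move=> fl fr; pose f1 := fglift (fun xy : M * N => f xy.1 xy.2) : F -> P.
have f1U x y : f1 (e x y) = f x y by rewrite /f1 liftU scale1r.
have fgZ r k (z : M * N) : r *: << k *g z >> = << r * k *g z >> :> F.
  by apply/eqP/freeg_eqP => w; rewrite coeffZ !coeffU mulrA.
have f1B : {morph f1 : u v / u - v} by exact: lift_is_additive.
have f1_0 : f1 0 = 0 by rewrite -(subrr 0) f1B subrr.
have f1N : {morph f1 : u / - u} by move=> u; rewrite -sub0r f1B f1_0 sub0r.
have f1D : {morph f1 : u v / u + v}.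
  by move=> u v; rewrite -[v in LHS]opprK f1B f1N opprK.
have f1Z r u : f1 (r *: u) = r *: f1 u.
  elim/freeg_ind_dom0: u => [|k [x y] u _ _ IH]; first by rewrite !(scaler0, f1_0).
  rewrite scalerDr !f1D IH scalerDr; congr (_ + _).
  by rewrite fgZ /f1 !liftU scalerA.
pose ker : {pred F} := [pred u | f1 u == 0].
have kerP : submod_closed ker.
  split=> [|r u v]; rewrite !inE ?f1_0 // => /eqP u0 /eqP v0.
  by rewrite f1D f1Z u0 v0 scaler0 addr0.
pose kerM := GRing.isSubmodClosed.Build R F ker kerP.
pose kerS : submodClosed F := HB.pack ker kerM.
have ker_rel w : tensor_rel w -> w \in kerS.
  have flD y : {morph f^~ y : x x' / x + x'}.
    by move=> x x'; have := fl y 1 x x'; rewrite !scale1r.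
  have frD x : {morph f x : y y' / y + y'}.
    by move=> y y'; have := fr x 1 y y'; rewrite !scale1r.
  have flZ y : scalable (f^~ y) := GRing.scalable_linear (fl y).
  have frZ x : scalable (f x) := GRing.scalable_linear (fr x).
  case=> *; apply/eqP; rewrite f1B ?f1D ?f1Z !f1U.
  - by rewrite flD subrr.
  - by rewrite frD subrr.
  - by rewrite flZ subrr.
  - by rewrite frZ subrr.
have kerE u v : pi u = pi v -> f1 u = f1 v.
  by move=> /tensor_piP/asboolP/(_ kerS ker_rel); rewrite inE f1B subr_eq0 => /eqP.
have gE u : f1 (repr (pi u)) = f1 u by apply: kerE; rewrite /tensor_pi reprK.
exists (fun t => f1 (repr t)); split.
  split=> [r t t'|x y]; last by rewrite gE f1U.
  have [u ->] := tensor_pi_surj t; have [v ->] := tensor_pi_surj t'.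
  by rewrite -tensor_piZ -tensor_piD !gE f1D f1Z.
move=> g [gl gf]; apply/funext => t; have [u ->] := tensor_pi_surj t.
have g0 : g 0 = 0 by have := gl (-1) 0 0; rewrite scaler0 addr0 scaleN1r addNr.
rewrite gE; elim/freeg_ind_dom0: u => [|k [x y] u _ _ IH].
  by rewrite f1_0 -[X in pi X](scale0r 0) tensor_piZ scale0r g0.
by rewrite f1D IH -[k]mulr1 -fgZ f1Z f1U tensor_piD tensor_piZ gl -/(tens x y) gf.
Qed.

End Tensor.

Definition ideal_gen (R : comNzRingType) (s : seq R) : {pred R} :=
  [pred w | `[< exists c : 'I_(size s) -> R,
                  w = \sum_(i < size s) c i * s`_i >]].

(* Ideals of [R] are the submodules of the regular module [R^o].  The two
   non-membership conditions are what "not principal" means here. *)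
Definition two_generated_monomial (K : fieldType) (G : numSemigroup)
    (I : submodClosed (semigroup_algebra K G)^o) : Prop :=
  exists (m n : nat) (mG : m \in G) (nG : n \in G),
    let u := sg_monomial K mG in let v := sg_monomial K nG in
    [/\ I =i ideal_gen [:: u; v], u \notin ideal_gen [:: v]
      & v \notin ideal_gen [:: u]].

(* Main.v *)
(* Up to isomorphism M = (1, x^s) with s, -s not in G.  Writing
   J = {f : f, x^s f in R} ~ Hom(M, R), any x with x, x+s, x+2s in G gives a
   torsion element of M (x) J, and it is nonzero as soon as x is not a sum y + z
   with y, y+s, z, z+s in G: the coefficient of the second generator of M,
   times J, is well defined modulo J J.

   Such an x is found as follows.  Let F be the Frobenius number.  If no y has
   both y and y+s in the Apery set of a, then x = F + a - s works.  Otherwise,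
   up to the sign of s, s = a h e + d j with j = k e + r and 0 < r < k.
   Symmetry of G forces a = k p + 2, and x = a h works if r = 1, while
   x = a h (p - e) + d (a - j) works if r >= 2. *)
From HB Require Import structures.
Require Import Defs.
From mathcomp Require Import all_boot all_order all_algebra.
From mathcomp Require Import boolp zify ring.
From mathcomp.multinomials Require Import freeg.

Import Order.TTheory GRing.Theory Num.Theory.
Local Open Scope ring_scope.

(** * Generalized arithmetic sequences *)

Section GenArithSeq.
Variables a h d k : nat.

(* [z] is the multiplicity of the generator [a], [Z] the total multiplicity of
   the generators [ah + id] with [i >= 1], and [I] the sum of their indices [i]:
   a number [I] is a sum of [Z] indices in [0..k] iff [I <= kZ]. *)
Definition gas_mem (n : int) : Prop :=
  exists z Z I : nat, (I <= k * Z)%N /\ n = (a * (z + h * Z) + d * I)%:Z.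

Lemma gas_mem_intro (n : int) (z Z I : nat) :
  (I <= k * Z)%N -> n = a%:Z * (z%:Z + h%:Z * Z%:Z) + d%:Z * I%:Z -> gas_mem n.
Proof.
by move=> IZ ->; exists z, Z, I; rewrite PoszD !PoszM PoszD PoszM.
Qed.

Lemma gas_mem0 : gas_mem 0.
Proof. by exists 0%N, 0%N, 0%N; rewrite !muln0. Qed.

Lemma gas_memD m n : gas_mem m -> gas_mem n -> gas_mem (m + n).
Proof.
move=> [z [Z [I [IZ ->]]]] [z' [Z' [I' [IZ' ->]]]].
exists (z + z')%N, (Z + Z')%N, (I + I')%N; split.
  by rewrite mulnDr leq_add.
by rewrite -PoszD !mulnDr !addnA; congr Posz; lia.
Qed.

Hypotheses (a_gt0 : (0 < a)%N) (h_gt0 : (0 < h)%N) (d_gt0 : (0 < d)%N).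
Hypotheses (k_gt0 : (0 < k)%N) (co_ad : coprime a d).

(** By coprimality [a] divides [i' - i]; the quotient cannot be negative because [i] is the least
    nonnegative residue. *)
Lemma residue_unique (q q' : int) (i i' : nat) : (i < a)%N ->
  a%:Z * q + d%:Z * i%:Z = a%:Z * q' + d%:Z * i'%:Z ->
  exists t : nat, i' = (i + a * t)%N /\ q = q' + d%:Z * t%:Z.
Proof.
move=> ia E.
have : (a%:Z %| (i'%:Z - i%:Z) * d%:Z)%Z by apply/dvdzP; exists (q - q'); lia.
rewrite Gauss_dvdzl; last by rewrite coprimezE.
case/dvdzP => u Eu.
have u0 : 0 <= u by nia.
case: u u0 Eu => // t _ Eu; exists t; split; first by lia.
have : a%:Z * (q - (q' + d%:Z * t%:Z)) = 0.
  by have /= := congr1 (fun x => d%:Z * x) Eu; lia.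
move/eqP; rewrite mulf_eq0; case/orP => /eqP; lia.
Qed.

(** Among the ways to write a number as [a q + d i] with [i >= 0], the one with [i < a] has the
    smallest [i] and the largest [q], so it inherits the bounds of any witness of membership. *)
Lemma gas_mem_inv (q : int) (i : nat) :
  (i < a)%N -> gas_mem (a%:Z * q + d%:Z * i%:Z) ->
  exists Z : nat, (i <= k * Z)%N /\ h%:Z * Z%:Z <= q.
Proof.
move=> ia [z [Z [I [IZ E]]]].
have [|t [IE ->]] := @residue_unique q (z%:Z + h%:Z * Z%:Z) i I ia; first by lia.
by exists Z; split; nia.
Qed.

(** Main test for non-membership: [q] leaves room for at most [t] generators other than [a], and
    their indices sum to at most [k t]. *)
Lemma gas_mem_bound (q : int) (i t : nat) :
  (i < a)%N -> q < h%:Z * (t%:Z + 1) -> gas_mem (a%:Z * q + d%:Z * i%:Z) ->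
  (i <= k * t)%N.
Proof.
move=> ia qt /gas_mem_inv [//|Z [iZ Zq]].
have Zt : (Z <= t)%N by nia.
by apply: leq_trans iZ _; rewrite leq_mul2l Zt orbT.
Qed.

(** Normal form on the Apery set of [a]: any slack in a representation would free a copy of [a]. In
    particular [Z] is the ceiling of [I / k]. *)
Lemma apery_gas y : gas_mem y -> ~ gas_mem (y - a%:Z) ->
  exists Z I : nat, [/\ (I < a)%N, (I <= k * Z)%N, (k * Z < I + k)%N
                      & y = (a * (h * Z) + d * I)%:Z].
Proof.
move=> [z [Z [I [IZ ->]]]] nP.
have z0 : z = 0%N.
  case: z nP => // z; case; exists z, Z, I; split=> //; lia.
subst z; exists Z, I.
have Ia : (I < a)%N.
  rewrite ltnNge; apply/negP => aI; apply: nP.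
  (* [d * a] is traded for [d] copies of the generator [a], one of which is subtracted. *)
  exists d.-1, Z, (I - a)%N; split; first by lia.
  have -> : I = ((I - a) + a)%N by lia.
  by rewrite addnK; case: d d_gt0 => // d' _; rewrite /=; lia.
split=> //.
rewrite ltnNge; apply/negP => IkZ; apply: nP.
case: Z IZ IkZ => [|Z] IZ IkZ; first by lia.
(* Carrying the same index sum with one generator fewer frees [h] copies of [a]. *)
exists h.-1, Z, I; split; first by lia.
by case: h h_gt0 => // h' _; rewrite /=; lia.
Qed.

(** Symmetry first forces [F + a] to be the Apery element in the class of [d (a - 1)]; applied then
    to the gap [a (h - 1) + d], it determines [a] modulo [k]. *)
Lemma symmetric_gas_dvd (F : int) : ~ gas_mem F ->
  (forall z, ~ gas_mem z -> gas_mem (F - z)) -> (1 < a)%N ->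
  exists p : nat, a = (k * p + 2)%N.
Proof.
move=> nF symF a_gt1.
(* The ceiling of [(a - 1) / k], so that [y0] is in the normal form of Apery elements. *)
pose c := ((a - 1 + (k - 1)) %/ k)%N.
have c1 : (a - 1 <= k * c)%N by rewrite /c; lia.
have c2 : (k * c < a - 1 + k)%N by rewrite /c; lia.
have c_gt0 : (0 < c)%N by nia.
pose y0 : int := a%:Z * (h%:Z * c%:Z) + d%:Z * (a - 1)%N%:Z.
have ny0 : ~ gas_mem (y0 - a%:Z).
  have -> : y0 - a%:Z = a%:Z * (h%:Z * c%:Z - 1) + d%:Z * (a - 1)%N%:Z.
    by rewrite /y0; lia.
  move/(@gas_mem_bound _ _ c.-1).
  have lt1 : (a - 1 < a)%N by lia.
  have lt2 : h%:Z * c%:Z - 1 < h%:Z * (c.-1%:Z + 1) by nia.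
  move/(_ lt1 lt2); nia.
have PFy0 := symF _ ny0.
have [Z [I [Ia IZ ZI E]]] : exists Z I : nat, [/\ (I < a)%N, (I <= k * Z)%N,
   (k * Z < I + k)%N & F - (y0 - a%:Z) = (a * (h * Z) + d * I)%:Z].
  apply: apery_gas => // PFy; apply: nF.
  have -> : F = (F - (y0 - a%:Z) - a%:Z) + y0 by lia.
  by apply: gas_memD => //; apply: (@gas_mem_intro _ 0 c (a - 1)) => //; lia.
(* Otherwise [d (a - 1) + d I = a d + d (I - 1)], and the spare copy of [a] makes [F] a member. *)
have I0 : I = 0%N.
  case: (posnP I) => // I_gt0; case: nF.
  apply: (@gas_mem_intro _ (d - 1) (c + Z) (I - 1)); first by nia.
  have d1 : (d - 1)%N%:Z = d%:Z - 1 by lia.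
  have I1 : (I - 1)%N%:Z = I%:Z - 1 by lia.
  have a1 : (a - 1)%N%:Z = a%:Z - 1 by lia.
  by move: E; rewrite /y0 d1 I1 a1; lia.
subst I.
have Z0 : Z = 0%N by nia.
subst Z.
have FE : F = y0 - a%:Z by lia.
have ny1 : ~ gas_mem (a%:Z * (h%:Z - 1) + d%:Z * 1%:Z).
  move/(@gas_mem_bound _ _ 0); rewrite muln0.
  by move=> /(_ a_gt1); lia.
have := symF _ ny1.
have -> : F - (a%:Z * (h%:Z - 1) + d%:Z * 1%:Z) =
   a%:Z * (h%:Z * (c%:Z - 1)) + d%:Z * (a - 2)%N%:Z.
  have a2 : (a - 2)%N%:Z = a%:Z - 2 by lia.
  have a1 : (a - 1)%N%:Z = a%:Z - 1 by lia.
  by rewrite FE /y0 a1 a2; lia.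
move/(@gas_mem_bound _ _ c.-1).
have lt1 : (a - 2 < a)%N by lia.
have lt2 : h%:Z * (c%:Z - 1) < h%:Z * (c.-1%:Z + 1) by nia.
move/(_ lt1 lt2) => le2.
(* [c2] gives the converse bound [k (c - 1) <= a - 2]. *)
by exists c.-1; nia.
Qed.

(** The excess [r = j - k e] measures how far [s] is from being a member; the normal forms of [y]
    and [y + s] give [0 < r < k]. *)
Lemma irreducible_two_step_of_apery_pair p s y : a = (k * p + 2)%N ->
  ~ gas_mem s ->
  forall Z I Z' I' : nat, (I <= k * Z)%N -> (k * Z < I + k)%N ->
  (I' < a)%N -> (I' <= k * Z')%N -> (k * Z' < I' + k)%N -> (I <= I')%N ->
  y = a%:Z * (h%:Z * Z%:Z) + d%:Z * I%:Z ->
  y + s = a%:Z * (h%:Z * Z'%:Z) + d%:Z * I'%:Z ->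
  exists x, [/\ gas_mem x, gas_mem (x + s), gas_mem (x + s + s) &
    forall u v, gas_mem u -> gas_mem (u + s) -> gas_mem v -> gas_mem (v + s) ->
      x <> u + v].
Proof.
move=> aE ns Z I Z' I' IZ ZI I'a I'Z' Z'I' II' yE ysE.
have ZZ' : (Z <= Z')%N by rewrite -ltnS -(ltn_pmul2l k_gt0) mulnS; lia.
pose e := (Z' - Z)%N; pose j := (I' - I)%N.
have eE : Z'%:Z = Z%:Z + e%:Z by rewrite /e; lia.
have jE : I'%:Z = I%:Z + j%:Z by rewrite /j; lia.
have sE : s = a%:Z * (h%:Z * e%:Z) + d%:Z * j%:Z.
  by have -> : s = y + s - y by [lia]; rewrite ysE yE eE jE; lia.
have ltj : (k * e < j)%N.
  rewrite ltnNge; apply/negP => lej; apply: ns.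
  by apply: (@gas_mem_intro _ 0 e j) => //; lia.
(* Otherwise [y = 0] and [s] is a member. Positivity of [I] gives [j <= k p], hence [e < p]. *)
have I_gt0 : (0 < I)%N.
  case: (posnP I) => // I0; have Z0 : Z = 0%N by nia.
  by move: ltj; rewrite /e /j I0 Z0 !subn0; lia.
pose r := (j - k * e)%N.
have r_gt0 : (0 < r)%N by rewrite /r; lia.
have rE : j = (k * e + r)%N by rewrite /r; lia.
have keE : (k * Z' = k * Z + k * e)%N by rewrite -mulnDr /e subnKC.
have r_ltk : (r < k)%N by rewrite /r /j; lia.
have e_ltp : (e < p)%N by rewrite -(ltn_pmul2l k_gt0); lia.
have kltk m : (k * m < k)%N -> m = 0%N by rewrite -{2}(muln1 k) ltn_pmul2l //; lia.
have noz u v : gas_mem (u + s) -> gas_mem (v + s) -> u = 0 \/ v = 0 -> False.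
  by move=> Pu Pv [u0|v0]; apply: ns; [move: Pu | move: Pv];
    rewrite ?u0 ?v0 add0r.
case: (leqP r 1) => [r1|r_gt1].
  have {}r1 : r = 1%N by lia.
  have jE1 : j = (k * e + 1)%N by rewrite rE r1.
  exists (a%:Z * h%:Z); split.
  - by apply: (@gas_mem_intro _ 0 1 0) => //; lia.
  - by apply: (@gas_mem_intro _ 0 (1 + e) j); [nia | rewrite sE; lia].
  (* The bound [2 k e + 2 <= k (1 + 2 e)] needs [k >= 2], which follows from [r = 1 < k]. *)
  - by apply: (@gas_mem_intro _ 0 (1 + e + e) (j + j)); [nia | rewrite sE; lia].
  move=> u v Pu Pus Pv Pvs E.
  case: (Pu) => [z1 [Z1 [I1 [IZ1 uE]]]].
  case: (Pv) => [z2 [Z2 [I2 [IZ2 vE]]]].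
  have E1 : (a * (z1 + z2 + h * (Z1 + Z2)) + d * (I1 + I2) = a * h)%N by lia.
  case: (posnP (Z1 + Z2)) => [Z0|Z_gt0].
    have Z10 : Z1 = 0%N by lia.
    have Z20 : Z2 = 0%N by lia.
    subst Z1 Z2.
    have I10 : I1 = 0%N by lia.
    have I20 : I2 = 0%N by lia.
    subst I1 I2.
    have zh : (z1 + z2 = h)%N by nia.
    have jlt : (j < a)%N by nia.
    (* If [z < h], then [w + s] has room for only [e] generators, whose index sum is at most
       [k e < j]. Both [z1] and [z2] are thus at least [h], against [z1 + z2 = h]. *)
    have aux (w : int) (z : nat) : w = a%:Z * z%:Z -> gas_mem (w + s) ->
        (h <= z)%N.
      move=> wE; rewrite sE wE.
      have -> : a%:Z * z%:Z + (a%:Z * (h%:Z * e%:Z) + d%:Z * j%:Z) =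
         a%:Z * (z%:Z + h%:Z * e%:Z) + d%:Z * j%:Z by lia.
      rewrite [(h <= z)%N]leqNgt => Pw; apply/negP => zlt.
      have : (j <= k * e)%N by apply: gas_mem_bound Pw => //; nia.
      by lia.
    have h1 : (h <= z1)%N by apply: (aux u) => //; lia.
    have h2 : (h <= z2)%N by apply: (aux v) => //; lia.
    by lia.
  have ahZ : (a * h <= a * (h * (Z1 + Z2)))%N by nia.
  have z0 : (a * (z1 + z2) + d * (I1 + I2) = 0)%N by nia.
  have z10 : z1 = 0%N by nia.
  have z20 : z2 = 0%N by nia.
  have I10 : I1 = 0%N by nia.
  have I20 : I2 = 0%N by nia.
  subst z1 z2 I1 I2.
  have Z1E : (Z1 + Z2 = 1)%N by nia.
  apply: (noz u v) => //.
  case: Z1 Z1E uE {IZ1 E1 z0 Z_gt0 ahZ} => [|Z1] Z1E uE; first by left; lia.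
  by right; have Z20 : Z2 = 0%N; [lia | subst Z2; lia].
have jlta : (j < a)%N by nia.
have ajE : (a - j)%N%:Z = a%:Z - j%:Z by lia.
have peE : (p - e)%N%:Z = p%:Z - e%:Z by lia.
pose x : int := a%:Z * (h%:Z * (p - e)%N%:Z) + d%:Z * (a - j)%N%:Z.
(* This passes to summands: [u] and [v] also lie in the Apery set. *)
have nxa : ~ gas_mem (x - a%:Z).
  have -> : x - a%:Z = a%:Z * (h%:Z * (p - e)%N%:Z - 1) + d%:Z * (a - j)%N%:Z.
    by rewrite /x; lia.
  move/(@gas_mem_bound _ _ (p - e).-1).
  have lt1 : (a - j < a)%N by lia.
  have lt2 : h%:Z * (p - e)%N%:Z - 1 < h%:Z * ((p - e).-1%:Z + 1) by nia.
  by move/(_ lt1 lt2); nia.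
exists x; split.
- by apply: (@gas_mem_intro _ 0 (p - e) (a - j)); [nia | rewrite /x; lia].
- apply: (@gas_mem_intro _ d p 0); first by lia.
  by rewrite /x sE ajE peE; lia.
- apply: (@gas_mem_intro _ d (p + e) j); first by nia.
  by rewrite /x sE ajE peE; lia.
move=> u v Pu Pus Pv Pvs E.
have nu : ~ gas_mem (u - a%:Z).
  by move=> Pua; apply: nxa; rewrite E addrAC; apply: gas_memD.
have nv : ~ gas_mem (v - a%:Z).
  by move=> Pva; apply: nxa; rewrite E -addrA; apply: gas_memD.
have [Z1 [I1 [I1a IZ1 ZI1 uE]]] := apery_gas u Pu nu.
have [Z2 [I2 [I2a IZ2 ZI2 vE]]] := apery_gas v Pv nv.
have E1 : (a * (h * (Z1 + Z2)) + d * (I1 + I2) = a * (h * (p - e)) + d * (a - j))%N.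
  by move: E; rewrite /x uE vE; lia.
have [||t [IE ZE]] :=
    @residue_unique (h%:Z * (p - e)%N%:Z) (h%:Z * (Z1 + Z2)%N%:Z) (a - j)%N (I1 + I2)%N.
- by lia.
- by lia.
(* Fewer generators would have index sum at most [k (p - e - 1) < a - j]. The bound leaves no room
   for a carry [t]. *)
have Zpe : (p - e <= Z1 + Z2)%N.
  have [//|lt] := leqP; exfalso.
  have le1 : (I1 + I2 <= k * (Z1 + Z2))%N by lia.
  have le2 : (k * (Z1 + Z2) <= k * (p - e).-1)%N by rewrite leq_mul2l; lia.
  have le3 : (k * (p - e).-1 < a - j)%N.
    have : (k * (p - e).-1 + k + k * e = k * p)%N.
      by rewrite -mulnSr prednK ?subn_gt0 // -mulnDr subnK // ltnW.
    by lia.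
  by lia.
have t0 : t = 0%N.
  case: (t) ZE => // t' ZE.
  have : h%:Z * (p - e)%N%:Z <= h%:Z * (Z1 + Z2)%N%:Z by rewrite ler_pM2l.
  have : 0 < d%:Z * t'.+1%:Z by rewrite mulr_gt0.
  by lia.
have {}ZE : (Z1 + Z2 = p - e)%N.
  move: ZE; rewrite t0 mulr0 addr0 => /mulfI; have -> : h%:Z != 0 by lia.
  by move=> /(_ isT) [].
rewrite {}t0 muln0 addn0 in IE.
(* [Io] is the index sum of the other summand; when it is positive, [Iw + j = a - Io] is already
   reduced modulo [a]. *)
have aux (w : int) (Zw Iw Io : nat) : w = (a * (h * Zw) + d * Iw)%N%:Z ->
    (Iw + Io = a - j)%N -> (0 < Io)%N -> gas_mem (w + s) ->
    (Iw + j <= k * (Zw + e))%N.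
  move=> wE IwE Io0.
  have -> : w + s = a%:Z * (h%:Z * (Zw + e)%N%:Z) + d%:Z * (Iw + j)%N%:Z.
    by rewrite wE sE; lia.
  by move/(@gas_mem_bound _ _ (Zw + e)); apply; [lia | rewrite ltr_pM2l //; lia].
have I1_gt0 : (0 < I1)%N.
  case: (posnP I1) => // I10; exfalso; apply: (noz u v) => //; left.
  have Z10 : Z1 = 0%N by apply: kltk; move: ZI1; rewrite I10.
  by rewrite uE I10 Z10; lia.
have I2_gt0 : (0 < I2)%N.
  case: (posnP I2) => // I20; exfalso; apply: (noz u v) => //; right.
  have Z20 : Z2 = 0%N by apply: kltk; move: ZI2; rewrite I20.
  by rewrite vE I20 Z20; lia.
have le1 : (I1 + j <= k * (Z1 + e))%N by apply: (aux u Z1 I1 I2) => //; lia.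
have le2 : (I2 + j <= k * (Z2 + e))%N by apply: (aux v Z2 I2 I1) => //; lia.
(* Adding [le1] and [le2] yields [a + j <= k (p + e)], whereas [a + j = k (p + e) + 2 + r]. *)
have : (k * (Z1 + e) + k * (Z2 + e) = k * p + k * e)%N.
  by rewrite -!mulnDr; congr (_ * _)%N; lia.
lia.
Qed.

Lemma irreducible_two_step (F : int) (s : int) : ~ gas_mem F ->
  (forall z, ~ gas_mem z -> z <= F) ->
  (forall z, ~ gas_mem z -> gas_mem (F - z)) ->
  ~ gas_mem s -> ~ gas_mem (- s) ->
  exists x, [/\ gas_mem x, gas_mem (x + s), gas_mem (x + s + s) &
    forall u v, gas_mem u -> gas_mem (u + s) -> gas_mem v -> gas_mem (v + s) ->
      x <> u + v].
Proof.
move=> nF maxF symF ns nNs.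
have Pa : gas_mem a by apply: (@gas_mem_intro _ 1 0 0); lia.
have a_gt1 : (1 < a)%N.
  rewrite ltnNge; apply/negP => a_le1; have a1 : a = 1%N by lia.
  case: s ns nNs => n; first by case; apply: (@gas_mem_intro _ n 0 0); lia.
  by move=> _; case; apply: (@gas_mem_intro _ n.+1 0 0); lia.
have [p aE] := symmetric_gas_dvd F nF symF a_gt1.
case: (EM (exists y, [/\ gas_mem y, ~ gas_mem (y - a%:Z), gas_mem (y + s) &
                         ~ gas_mem (y + s - a%:Z)])) => [[y [Py ny Pys nys]]|nex].
  have [Z [I [Ia IZ ZI yE]]] := apery_gas y Py ny.
  have [Z' [I' [I'a I'Z' Z'I' ysE]]] := apery_gas (y + s) Pys nys.
  case: (leqP I I') => [II'|/ltnW I'I].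
    by apply: (@irreducible_two_step_of_apery_pair p s y aE ns Z I Z' I') => //; lia.
  have [||x [Px Pxs Pxss xP]] :=
    @irreducible_two_step_of_apery_pair p (- s) (y + s) aE nNs Z' I' Z I I'Z' Z'I' Ia IZ ZI
      I'I; try lia.
  (* For [-s] the progression runs downwards from [x]; its last term is the first one for [s]. *)
  exists (x - s - s); split; rewrite ?subrK // => u v Pu Pus Pv Pvs E.
  by apply: (xP (u + s) (v + s)); rewrite ?addrK //; lia.
exists (F + a%:Z - s); split.
- by rewrite addrAC; apply: gas_memD => //; apply: symF.
- rewrite subrK; apply: contrapT => /maxF; lia.
- rewrite subrK addrAC -[s]opprK; apply: gas_memD => //; exact: symF.
(* Since [F + a = u + (v + s) = (u + s) + v], membership of [u - a] or of [u + s - a] would make [F]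
   a member. *)
move=> u v Pu Pus Pv Pvs E; apply: nex; exists u; split=> // Pua; apply: nF.
- by have -> : F = (u - a%:Z) + (v + s) by [lia]; apply: gas_memD.
- by have -> : F = (u + s - a%:Z) + v by [lia]; apply: gas_memD.
Qed.

End GenArithSeq.

(** * Comparison of the semigroup with its arithmetic description *)

Lemma mem_semigroup_gen (s : seq nat) n : n \in s -> n \in semigroup_gen s.
Proof.
move=> ns; have lt_i : (index n s < size s)%N by rewrite index_mem.
apply/asboolP; exists (fun i => val i == index n s : nat).
rewrite (bigD1 (Ordinal lt_i)) //= eqxx mul1n nth_index // big1 ?addn0 // => i.
by rewrite -val_eqE /= => /negbTE ->.
Qed.

(** For the converse, induct on [Z]: while [I > k], split off the generator of index [k]; once
    [I <= k], a single generator carries all of [I]. *)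
Lemma int_mem_gas (a h d k : nat) (G : numSemigroup) (z : int) :
  G =i semigroup_gen (gen_arith_seq a h d k) ->
  int_mem G z <-> gas_mem a h d k z.
Proof.
move=> GE; have mem_gen t : t \in gen_arith_seq a h d k -> t \in G.
  by rewrite GE; apply: mem_semigroup_gen.
have muln_mem c t : t \in G -> (c * t)%N \in G.
  move=> tG; elim: c => [|c IHc]; first exact: sg_mem0.
  by rewrite mulSn sg_memD.
have aG : a \in G by rewrite mem_gen // mem_head.
have gen_mem i : (0 < i <= k)%N -> (a * h + i * d)%N \in G.
  move=> ik; apply: mem_gen; rewrite in_cons; apply/orP; right.
  by apply/mapP; exists i; rewrite // mem_iota; lia.
split.
  case: z => [n|//] /=; rewrite GE => /asboolP[c ->].
  apply: (big_ind (fun t : nat => gas_mem a h d k t)).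
  - exact: gas_mem0.
  - by move=> t t' Pt Pt'; rewrite PoszD; apply: gas_memD.
  move=> i _; have := mem_nth 0%N (ltn_ord i).
  rewrite in_cons => /orP[/eqP ->|/mapP[j]].
    by exists (c i), 0%N, 0%N; split=> //; lia.
  rewrite mem_iota => jk ->; exists 0%N, (c i), (c i * j)%N; split; last by lia.
  by rewrite mulnC leq_mul2r; lia.
case=> t [Z [I [IZ ->]]] /=; rewrite mulnDr -addnA sg_memD //.
  by rewrite mulnC; apply: muln_mem.
elim: Z I IZ {t} => [|Z IHZ] I IZ.
  by have -> : I = 0%N by [lia]; rewrite !muln0 sg_mem0.
have [Ik|kI] := leqP I k.
  have -> : (a * (h * Z.+1) + d * I = Z * (h * a) + (a * h + I * d))%N by lia.
  apply: sg_memD; first by apply/muln_mem/muln_mem.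
  case: (posnP I) => [->|I0]; first by rewrite mul0n addn0 mulnC; apply: muln_mem.
  by apply: gen_mem; rewrite I0 Ik.
have -> : (a * (h * Z.+1) + d * I =
           (a * (h * Z) + d * (I - k)) + (a * h + k * d))%N.
  by have {1}-> : I = ((I - k) + k)%N; lia.
apply: sg_memD; first by apply: IHZ; lia.
case: (posnP k) => [k0|k0]; first by lia.
by apply: gen_mem; rewrite k0 leqnn.
Qed.

(** * Torsion of the tensor product *)

Lemma fglift_linear (R : comNzRingType) (T : choiceType) (P : lmodType R)
  (f : T -> P) : linear (fglift f : {freeg T / R} -> P).
Proof.
move=> r u v.
have fB : {morph fglift f : u v / u - v} by exact: lift_is_additive.
have f0 : fglift f 0 = 0 by rewrite -(subrr 0) fB subrr.
have fN : {morph fglift f : u / - u} by move=> w; rewrite -sub0r fB f0 sub0r.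
have fD : {morph fglift f : u v / u + v}.
  by move=> w w'; rewrite -[w' in LHS]opprK fB fN opprK.
rewrite fD; congr (_ + _).
elim/freeg_ind_dom0: u => [|c x u _ _ IH]; first by rewrite !(scaler0, f0).
rewrite scalerDr !fD IH scalerDr; congr (_ + _).
have -> : r *: << c *g x >> = << r * c *g x >> :> {freeg T / R}.
  by apply/eqP/freeg_eqP => w; rewrite coeffZ !coeffU mulrA.
by rewrite !liftU scalerA.
Qed.

(** [f] is bilinear modulo [D], so it induces a map from the tensor product to [P / D]; the quotient
    is expressed by membership in [D]. The preimage of [D] under the free extension of [f] contains
    the tensor relations. *)
Lemma tens_eq_mem (R : comNzRingType) (M N P : lmodType R)
    (D : submodClosed P) (f : M -> N -> P) :
  (forall r x x' y, f (r *: x + x') y - (r *: f x y + f x' y) \in D) ->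
  (forall x, linear (f x)) ->
  forall x x' y y', tens x y = tens x' y' -> f x y - f x' y' \in D.
Proof.
move=> fl fr x x' y y'.
pose F := fglift (fun p : M * N => f p.1 p.2) : {freeg (M * N)%type / R} -> P.
have Flin : linear F by exact: fglift_linear.
have FB u v : F (u - v) = F u - F v by exact: lift_is_additive.
have FD u v : F (u + v) = F u + F v by rewrite -[u]scale1r Flin !scale1r.
have FZ r u : F (r *: u) = r *: F u by exact: (GRing.scalable_linear Flin).
have FU z w : F << (z, w) >> = f z w by rewrite /F liftU scale1r.
pose S : {pred {freeg (M * N)%type / R}} := [pred u | F u \in D].
have S_closed : submod_closed S.
  split=> [|r u v]; rewrite !inE.
    by rewrite -[0](scale0r 0) FZ scale0r rpred0.
  by move=> uS vS; rewrite Flin rpredD // rpredZ.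
pose S_mixin := GRing.isSubmodClosed.Build R _ S S_closed.
pose SD : submodClosed {freeg (M * N)%type / R} := HB.pack S S_mixin.
(* At zero the defect of additivity is [- f 0 w]. *)
have f0 w : f 0 w \in D.
  have := fl 1 0 0 w; rewrite !scale1r addr0 opprD addrA subrr sub0r.
  by move=> Df; rewrite -[f 0 w]opprK -scaleN1r rpredZ.
have S_rel u : tensor_rel u -> u \in SD.
  case=> [z z' w | z w w' | r z w | r z w]; rewrite inE FB ?FD ?FZ !FU.
  - by have := fl 1 z z' w; rewrite !scale1r.
  - by have := fr z 1 w w'; rewrite !scale1r => ->; rewrite subrr rpred0.
  - have := rpredD (fl r z 0 w) (f0 w).
    by rewrite addr0 opprD addrA subrK.
  - by rewrite (GRing.scalable_linear (fr z)) subrr rpred0.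
move=> /tensor_piP/asboolP/(_ SD S_rel).
by rewrite inE FB !FU.
Qed.

Lemma ideal_gen2P (R : comNzRingType) (u v w : R) :
  w \in ideal_gen [:: u; v] <-> exists b c, w = b * u + c * v.
Proof.
split=> [/asboolP[c ->]|[b [c ->]]].
  by exists (c ord0), (c (fintype.lift ord0 ord0)); rewrite big_ord_recl big_ord1.
apply/asboolP; exists (fun i => if val i == 0%N then b else c).
by rewrite big_ord_recl big_ord1.
Qed.

Lemma ideal_genC (R : comNzRingType) (u v : R) :
  ideal_gen [:: u; v] =i ideal_gen [:: v; u].
Proof.
by move=> w; apply/idP/idP => /ideal_gen2P[b [c ->]]; apply/ideal_gen2P;
  exists c, b; rewrite addrC.
Qed.

Lemma mem_ideal_gen1 (R : comNzRingType) (u w : R) :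
  (exists b, w = b * u) -> w \in ideal_gen [:: u].
Proof.
by case=> b ->; apply/asboolP; exists (fun=> b); rewrite big_ord1.
Qed.

Lemma Hom_scaleE (R : comNzRingType) (M N : lmodType R) (r : R)
  (phi : Hom_module M N) (w : M) : val (r *: phi) w = r *: val phi w.
Proof. by []. Qed.

Section TwoGenerated.
Variables (R : comNzRingType) (u v : R) (M : submodClosed R^o).
Hypotheses (u_lreg : GRing.lreg u) (ME : M =i ideal_gen [:: u; v]).

(** The homomorphism is multiplication by [p / u]: the equation makes [p w] divisible by [u] for [w]
    in [M], and regularity of [u] makes the quotient unique, hence linear. *)
Lemma multiplication_hom (p p' : R) : u * p' = v * p ->
  exists phi : Hom_module (submodule M) R^o,
    forall w : submodule M, u * val phi w = p * val w.
Proof.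
move=> pE.
have /choice[f fE] (w : submodule M) : exists r : R^o, u * r = p * val w.
  have := valP w; rewrite ME => /ideal_gen2P[b [c ->]].
  by exists (b * p + c * p'); ring: pE.
have f_lin : f \in @linear_pred R (submodule M) R^o.
  apply/asboolP => r w w'; apply: u_lreg.
  rewrite fE linearP /=.
  have -> : u * (r *: f w + f w' : R^o) = r * (u * f w) + u * f w'.
    by rewrite [LHS]mulrDr [u * (r * _)]mulrCA.
  by rewrite !fE mulrDr [_ * (r * _)]mulrCA.
by exists (exist _ f f_lin).
Qed.

(* [u * q = v * j] says that [j] lies in J, i.e. that [j] is the value at [u] of
   some element of Hom(M, R); so [D] is any submodule containing J J. *)
Lemma torsion_two_generated (p0 p1 p2 : R) (D : submodClosed R^o) :
  v != 0 -> u * p1 = v * p0 -> u * p2 = v * p1 ->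
  (forall j f q q', u * q = v * j -> u * q' = v * f -> (j * f : R^o) \in D) ->
  (p0 : R^o) \notin D ->
  exists t : tensor_module (submodule M) (Hom_module (submodule M) R^o),
    torsion t /\ t <> 0.
Proof.
move=> v_neq0 p1E p2E JJ p0D.
have uM : (u : R^o) \in M.
  by rewrite ME; apply/ideal_gen2P; exists 1, 0; rewrite mul1r mul0r addr0.
have vM : (v : R^o) \in M.
  by rewrite ME; apply/ideal_gen2P; exists 0, 1; rewrite mul1r mul0r add0r.
pose U : submodule M := exist _ (u : R^o) uM.
pose V : submodule M := exist _ (v : R^o) vM.
have [phi0 phi0E] := multiplication_hom _ _ p1E.
have [phi1 phi1E] := multiplication_hom _ _ p2E.
(* Multiplication by [v] kills it: [v U = u V] and [u phi1 = v phi0]. *)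
exists (tens U phi1 - tens V phi0); split.
  exists v => //; rewrite scalerBr -!tensZl.
  have -> : v *: U = u *: V by apply: val_inj; exact: mulrC.
  have homE : u *: phi1 = v *: phi0.
    apply: val_inj; apply/funext => w; apply: u_lreg.
    rewrite !Hom_scaleE.
    have -> : u * (u *: val phi1 w) = u * (p1 * val w) by rewrite -phi1E.
    have -> : u * (v *: val phi0 w) = v * (p0 * val w) by rewrite -phi0E mulrCA.
    by rewrite !mulrA p1E.
  by rewrite !tensZl -!tensZr homE subrr.
have hom_in_J (phi : Hom_module (submodule M) R^o) :
    u * val phi V = v * val phi U.
  have /asboolP phi_lin := valP phi.
  have phiZ r w : r * val phi w = val phi (r *: w).
    by have := GRing.scalable_linear phi_lin r w.
  by rewrite !phiZ; congr (val phi _); apply: val_inj; exact: mulrC.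
(* A chosen coefficient of [v], not linear in [w]; by [bJ] below it is determined modulo J. *)
have /choice[b bE] (w : submodule M) :
    exists b : R, exists c, val w = c * u + b * v.
  have := valP w; rewrite ME => /ideal_gen2P[c [b ->]].
  by exists b, c.
move/subr0_eq => tE.
have bJ (w : submodule M) (j c : R) : val w = c * u + j * v ->
    exists q, u * q = v * (b w - j).
  have [c' ->] := bE w => E; exists (c - c').
  rewrite mulrC [v * _]mulrC !mulrBl; apply/eqP.
  by rewrite subr_eq addrAC eq_sym subr_eq addrC E addrC.
have fD : (b U * val phi1 U - b V * val phi0 U : R^o) \in D.
  apply: (@tens_eq_mem R (submodule M) (Hom_module (submodule M) R^o) R^o D
    (fun w phi => b w * val phi U)) tE.
  - move=> r w w' phi; have [c cE] := bE w; have [c' cE'] := bE w'.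
    have [|q qE] := bJ (r *: w + w') (r * b w + b w') (r * c + c').
      by rewrite linearP /= cE cE' /GRing.scale /=; ring.
    by have := JJ _ _ _ _ qE (hom_in_J phi); rewrite mulrBl mulrDl -mulrA.
  - move=> w r phi psi; rewrite /= mulrDr; congr (_ + _); exact: mulrCA.
have phi0U : val phi0 U = p0 by apply: u_lreg; rewrite (phi0E U) mulrC.
have phi1U : val phi1 U = p1 by apply: u_lreg; rewrite (phi1E U) mulrC.
have [|q qE] := bJ U 0 1; first by rewrite mul1r mul0r addr0.
have [|q' qE'] := bJ V 1 0; first by rewrite mul1r mul0r add0r.
have bUD := JJ _ _ _ _ qE p2E; have bVD := JJ _ _ _ _ qE' p1E.
rewrite phi0U phi1U in fD; case/negP: p0D.
rewrite subr0 in bUD.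
(* Modulo J, [b U] is 0 and [b V] is 1, so [fD] reduces to [p0] modulo [D]. *)
have -> : p0 = b U * p1 + (-1) *: ((b V - 1) * p0 + (b U * p1 - b V * p0) : R^o).
  by rewrite scaleN1r; ring.
by rewrite rpredD // rpredZ // rpredD.
Qed.

End TwoGenerated.

(** * Monomial ideals of the semigroup algebra *)

Lemma coefM_neq0 (A : idomainType) (p q : {poly A}) n : (p * q)`_n != 0 ->
  exists i j, [/\ n = (i + j)%N, p`_i != 0 & q`_j != 0].
Proof.
move=> pq; have [/forallP pq0|] :=
    boolP [forall i : 'I_n.+1, p`_i * q`_(n - i) == 0].
  by move: pq; rewrite coefM big1 ?eqxx // => i _; apply/eqP/pq0.
rewrite negb_forall => /existsP[i]; rewrite mulf_eq0 negb_or => /andP[pi qi].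
by exists (i : nat), (n - i)%N; rewrite subnKC // -ltnS.
Qed.

Section SemigroupAlgebra.
Variables (K : fieldType) (G : numSemigroup).
Local Notation R := (semigroup_algebra K G).

Lemma sg_monomial_lreg n (nG : n \in G) : GRing.lreg (sg_monomial K nG).
Proof.
move=> p q /(congr1 val) /= E; apply: val_inj; apply: mulfI E.
by rewrite monic_neq0 // monicXn.
Qed.

Lemma sg_monomial_neq0 n (nG : n \in G) : sg_monomial K nG != 0.
Proof. by rewrite -(inj_eq val_inj) /= monic_neq0 // monicXn. Qed.

Lemma sg_monomialM m n m' n' (mG : m \in G) (nG : n \in G) (mG' : m' \in G)
    (nG' : n' \in G) : (m + n = m' + n')%N ->
  sg_monomial K mG * sg_monomial K nG = sg_monomial K mG' * sg_monomial K nG'.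
Proof. by move=> E; apply: val_inj; rewrite /= -!exprD E. Qed.

(** Cancelling the monomial of exponent [m] gives [q = 'X^s * p], so the support of [q] is that of
    [p] shifted by [s]. *)
Lemma sg_shift_supp m s (mG : m \in G) (msG : (m + s)%N \in G) (p q : R) n :
  sg_monomial K mG * q = sg_monomial K msG * p ->
  (val p)`_n != 0 -> (n \in G) && ((n + s)%N \in G).
Proof.
move=> /(congr1 val) /=; rewrite exprD -mulrA => /mulfI E pn.
have qn : (val q)`_(n + s) = (val p)`_n.
  by rewrite /= E ?monic_neq0 ?monicXn // coefXnM ltnNge leq_addl addnK.
rewrite (supported_inP _ _ (valP p) _ pn); apply: (supported_inP _ _ (valP q)).
by rewrite qn.
Qed.

Lemma torsion_of_irreducible_two_step (M : submodClosed R^o)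
    (m s x : nat) (mG : m \in G) (msG : (m + s)%N \in G) :
  M =i ideal_gen [:: sg_monomial K mG; sg_monomial K msG] ->
  x \in G -> (x + s)%N \in G -> (x + s + s)%N \in G ->
  (forall y z, y \in G -> (y + s)%N \in G -> z \in G -> (z + s)%N \in G ->
    x <> (y + z)%N) ->
  exists t : tensor_module (submodule M) (Hom_module (submodule M) R^o),
    torsion t /\ t <> 0.
Proof.
move=> ME xG xsG xssG x_irr.
pose decomposable n := exists y z, [/\ n = (y + z)%N,
  (y \in G) && ((y + s)%N \in G) & (z \in G) && ((z + s)%N \in G)].
(* Described by exponents, [D] contains J J and visibly excludes the monomial of exponent [x]. *)
pose D : {pred R^o} :=
  [pred p : R^o | `[< forall n, (val (p : R))`_n != 0 -> decomposable n >]].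
have D_closed : submod_closed D.
  split; first by apply/asboolP => n; rewrite coef0 eqxx.
  move=> r p q /asboolP pD /asboolP qD; apply/asboolP => n.
  rewrite (_ : val _ = val r * val p + val q) // coefD => rpq.
  have [rp0|rp] := eqVneq (val r * val p)`_n 0.
    by apply: qD; rewrite rp0 add0r in rpq.
  have [i [j [-> ri pj]]] := coefM_neq0 _ _ _ _ rp.
  have [y [z [-> /andP[yG ysG] zG]]] := pD _ pj.
  have iG := supported_inP _ _ (valP r) _ ri.
  exists (i + y)%N, z; split; [exact: addnA | | exact: zG].
  by rewrite sg_memD // -addnA sg_memD.
pose D_mixin := GRing.isSubmodClosed.Build R R^o D D_closed.
pose SD : submodClosed R^o := HB.pack D D_mixin.
apply: (@torsion_two_generated R _ _ M (sg_monomial_lreg _ mG) ME (sg_monomial K xG)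
  (sg_monomial K xsG) (sg_monomial K xssG) SD).
- exact: sg_monomial_neq0.
- by apply: sg_monomialM; rewrite addnA addnAC.
- by apply: sg_monomialM; rewrite addnA addnAC.
- move=> j f q q' jE fE; apply/asboolP => n /coefM_neq0[i [l [-> ji fl]]].
  by exists i, l; split=> //; [exact: sg_shift_supp jE ji | exact: sg_shift_supp fE fl].
apply/negP => /asboolP /(_ x) [|y [z [E /andP[yG ysG] /andP[zG zsG]]]].
  by rewrite /= coefXn eqxx oner_neq0.
exact: (x_irr y z).
Qed.

End SemigroupAlgebra.

Theorem theorem1p2 (a h d k : nat)
    (a_ge1 : (1 <= a)%N) (h_ge1 : (1 <= h)%N) (d_ge1 : (1 <= d)%N)
    (k_ge1 : (1 <= k)%N) (coprime_ad : gcdn a d = 1%N)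
    (G : numSemigroup) (GE : G =i semigroup_gen (gen_arith_seq a h d k))
    (symG : symmetric_semigroup G) (K : fieldType)
    (M : submodClosed (semigroup_algebra K G)^o)
    (M2 : two_generated_monomial M) :
  exists t : tensor_module (submodule M)
                           (Hom_module (submodule M) (semigroup_algebra K G)^o),
    torsion t /\ t <> 0.
Proof.
have int_memE := int_mem_gas a h d k G _ GE.
have [F [/negP nF maxF] symF] := symG.
have co : coprime a d by rewrite /coprime coprime_ad.
suff main (m s : nat) (mG : m \in G) (msG : (m + s)%N \in G) :
    M =i ideal_gen [:: sg_monomial K mG; sg_monomial K msG] ->
    sg_monomial K msG \notin ideal_gen [:: sg_monomial K mG] ->
    exists t : tensor_module (submodule M)
                             (Hom_module (submodule M) (semigroup_algebra K G)^o),
    torsion t /\ t <> 0.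
  have [m [n [mG [nG [ME un vn]]]]] := M2.
  case: (leqP m n) => [mn|/ltnW nm].
    have [s sE] : exists s, n = (m + s)%N by exists (n - m)%N; rewrite subnKC.
    by subst n; exact: main ME vn.
  have [s sE] : exists s, m = (n + s)%N by exists (m - n)%N; rewrite subnKC.
  subst m; apply: main un => w.
  by rewrite ME; apply: ideal_genC.
move=> ME vn.
(* Otherwise the second monomial is a multiple of the first. *)
have nsG : ~ int_mem G s%:Z.
  move=> /= sG; case/negP: vn; apply: mem_ideal_gen1.
  exists (sg_monomial K sG); apply: val_inj.
  by rewrite /= -exprD addnC.
have nNsG : ~ int_mem G (- s%:Z).
  by case: (s) nsG => [|//]; rewrite oppr0.
have [|||||x [Px Pxs Pxss x_irr]] :=
  irreducible_two_step a h d k a_ge1 h_ge1 d_ge1 k_ge1 co F s%:Z.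
- by rewrite -int_memE.
- by move=> z; rewrite -int_memE => /negP; exact: maxF.
- by move=> z; rewrite -!int_memE => /negP; exact: symF.
- by rewrite -int_memE.
- by rewrite -int_memE.
rewrite -!int_memE in Px Pxs Pxss.
case: x Px Pxs Pxss x_irr => // x Px Pxs Pxss x_irr.
apply: (@torsion_of_irreducible_two_step K G M m s x mG msG ME Px Pxs Pxss).
move=> y z yG ysG zG zsG E.
by apply: (x_irr y%:Z z%:Z); rewrite -?int_memE // E PoszD.
Qed.
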